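(* A polynomial subspace $U\in\mathcal G_k\mathcal P_n$ and its apolar dual $U^*\in\mathcal G_\ell\mathcal P_n$ have the same Wronskian covariant: $W(U)=W(U^* )$ as elements of $\mathcal G_1\mathcal P_{k\ell}$ (i.e. the Wronskian polynomials of a basis of $U$ and of a basis of $U^*$ agree up to a nonzero scalar multiple).
   Context: Work over $\mathbb C$. $\mathcal P_m$ is the vector space of polynomials in $z$ of degree $\le m$; $\mathcal G_k\mathcal P_n$ is the Grassmannian of $k$-dimensional subspaces of $\mathcal P_n$. Fix integers $n\ge0$, $1\le k\le n+1$, and put $\ell=n+1-k$. Let $\gamma:\mathcal P_n\times\mathcal P_n\to\mathbb C$ be the non-degenerate bilinear form with $n!\,\gamma\!\left(\frac{z^i}{i!},\frac{z^j}{j!}\right)=(-1)^i$ if $i+j=n$, and $0$ otherwise ($0\le i,j\le n$). The apolar dual of $U\in\mathcal G_k\mathcal P_n$ is $U^*=\{u\in\mathcal P_n:\gamma(u,v)=0\text{ for all }v\in U\}$, of dimension $\ell$. The Wronskian of polynomials $p_1,\dots,p_r$ is $W(p_1,\dots,p_r)=\det(p_i^{(j-1)})_{1\le i,j\le r}$ (equal to $1$ when $r=0$). For an $r$-dimensional subspace $V\subset\mathcal P_n$ with basis $p_1,\dots,p_r$, $W(V)=\mathrm{span}\{W(p_1,\dots,p_r)\}\in\mathcal G_1\mathcal P_{r(n+1-r)}$, independent of the basis. *)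

(* Defs.v *)
From HB Require Import structures.
From mathcomp Require Import all_boot all_algebra.
Set Implicit Arguments.
Unset Strict Implicit.
Unset Printing Implicit Defensive.
Import GRing.Theory.
Local Open Scope ring_scope.

(* Throughout, P_m is {poly_m.+1 K}, the polynomials of size at most m + 1. *)

Definition grassmannian (K : fieldType) (vT : vectType K) (r : nat)
  : {pred {vspace vT}} := [pred V : {vspace vT} | \dim V == r].
Arguments grassmannian {K} vT r.

Section Apolarity.
Variables (K : fieldType) (n : nat).

(* u`_i * i!%:R is the coordinate of u on z^i / i!, so this is the bilinear
   extension of the values on pairs (z^i / i!, z^j / j!). *)
Definition apolar_form (u v : {poly_n.+1 K}) : K :=
  \sum_(i < n.+1) \sum_(j < n.+1)
    (u`_i * i`!%:R) * (v`_j * j`!%:R) *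
    (if (i + j == n)%N then (-1) ^+ i / n`!%:R else 0).

Fact apolar_form_bilinear : bilinear_for
  (GRing.Scale.Law.clone _ _ *%R _)
  (GRing.Scale.Law.clone _ _ (idfun \; *%R) _) apolar_form.
Proof.
split=> [v a u u'|u a v v']; rewrite /= /apolar_form mulr_sumr -big_split;
  apply: eq_bigr => i _; rewrite mulr_sumr -big_split; apply: eq_bigr => j _;
  rewrite /= !(coefD, coefZ, mulrDl, mulrDr).
- by rewrite !mulrA.
- by rewrite mulrA !mulrA [_ * i`!%:R * a]mulrC !mulrA.
Qed.

HB.instance Definition _ :=
  bilinear_isBilinear.Build K {poly_n.+1 K} {poly_n.+1 K} K
  (GRing.Scale.Law.clone _ _ *%R _)
  (GRing.Scale.Law.clone _ _ (idfun \; *%R) _)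
    apolar_form apolar_form_bilinear.

Fact apolar_form_sym u v :
  apolar_form u v = (-1) ^+ odd n * idfun (apolar_form v u).
Proof.
rewrite /apolar_form exchange_big mulr_sumr; apply: eq_bigr => j _.
rewrite mulr_sumr; apply: eq_bigr => i _ /=.
rewrite [RHS]mulrCA [v`_j * _ * _]mulrC; congr (_ * _).
rewrite [(j + i)%N]addnC; case: eqP => [ijn|_]; last by rewrite mulr0.
rewrite mulrA; congr (_ / _); rewrite signr_odd -exprD.
have -> : (n + j = i + 2 * j)%N by rewrite mul2n -addnn addnA ijn.
by rewrite exprD exprM sqrrN !expr1n mulr1.
Qed.

(* The form is symmetric for even n and skew-symmetric for odd n, so that the
   library's orthogonal complements apply. *)
HB.instance Definition _ :=
  isHermitianSesquilinear.Build K {poly_n.+1 K} (odd n) idfun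
    apolar_form apolar_form_sym.

Definition apolar_dual (U : {vspace {poly_n.+1 K}}) : {vspace {poly_n.+1 K}} :=
  orthov (apolar_form : {hermitian {poly_n.+1 K} for odd n & idfun}) U.

Lemma apolar_dualP (U : {vspace {poly_n.+1 K}}) (u : {poly_n.+1 K}) :
  reflect (forall v, v \in U -> apolar_form u v = 0) (u \in apolar_dual U).
Proof. exact: mem_orthovP. Qed.

Lemma apolar_formE (i j : 'I_n.+1) :
  (forall m, (m`!%:R : K) != 0) ->
  n`!%:R * apolar_form (npolyp n.+1 (i`!%:R^-1 *: 'X^i))
                       (npolyp n.+1 (j`!%:R^-1 *: 'X^j)) =
  if (i + j == n)%N then (-1) ^+ i else 0.
Proof.
move=> fact_neq0; rewrite /apolar_form (bigD1 i) //= [X in _ * (_ + X)]big1 ?addr0 => [|i' nei']; last first.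
  apply: big1 => j' _; rewrite coef_npolyp ltn_ord coefZ coefXn.
  by rewrite (negPf (nei' : i' != i :> nat)) !(mulr0, mul0r).
rewrite (bigD1 j) //= [X in _ * (_ + X)]big1 ?addr0 => [|j' nej']; last first.
  rewrite [X in _ * (X * _)]coef_npolyp ltn_ord coefZ coefXn.
  by rewrite (negPf (nej' : j' != j :> nat)) !(mulr0, mul0r).
rewrite !coef_npolyp !ltn_ord !coefZ !coefXn !eqxx !mulr1 !mulVf // !mul1r.
by case: ifP => _; rewrite ?mulr0 // mulrCA divff ?mulr1.
Qed.

End Apolarity.

Section Wronskian.
Variables (K : fieldType) (n : nat).

Definition wronskian r (p : r.-tuple {poly_n.+1 K}) : {poly K} :=
  \det (\matrix_(i < r, j < r) (polyn (tnth p i))^`(j)).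

(* W(V) inside P_m. The value of [insubd] is 0 when its argument is not in P_m,
   so a line is obtained only if the Wronskian is a nonzero element of P_m. *)
Definition wronskian_space (m : nat) (V : {vspace {poly_n.+1 K}})
  : {vspace {poly_m.+1 K}} := <[insubd (0%R : {poly_m.+1 K}) (wronskian (vbasis V))]>%VS.

Lemma wronskian_basis (V : {vspace {poly_n.+1 K}}) r
    (p q : r.-tuple {poly_n.+1 K}) :
  basis_of V p -> basis_of V q ->
  exists2 c : K, c != 0 & wronskian p = c *: wronskian q.
Proof.
have change (s t : r.-tuple {poly_n.+1 K}) : basis_of V s -> basis_of V t ->
  wronskian s = \det (\matrix_(i, j) coord t j (tnth s i)) *: wronskian t.
  move=> sV tV; rewrite -mul_polyC -det_map_mx -det_mulmx; congr (\det _).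
  apply/matrixP => i j; rewrite !mxE.
  have siV : tnth s i \in V by apply: (basis_mem sV); exact: mem_tnth.
  rewrite {1}(coord_basis tV siV) !linear_sum; apply: eq_bigr => l _.
  by rewrite /= derivnZ !mxE mul_polyC (tnth_nth 0 t).
move=> pV qV; exists (\det (\matrix_(i, j) coord q j (tnth p i))); last exact: change.
rewrite -unitfE -unitmxE.
suff /mulmx1_unit[] : (\matrix_(i, j) coord q j (tnth p i)) *m
   (\matrix_(i, j) coord p j (tnth q i)) = 1%:M by [].
apply/matrixP => i j; rewrite !mxE.
have piV : tnth p i \in V by apply: (basis_mem pV); exact: mem_tnth.
transitivity (coord p j (tnth p i)).
  rewrite [in RHS](coord_basis qV piV) linear_sum; apply: eq_bigr => l _.
  by rewrite !mxE linearZ (tnth_nth 0 q).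
by rewrite [in LHS](tnth_nth 0) coord_free ?(basis_free pV).
Qed.

Lemma wronskian_spaceE m (V : {vspace {poly_n.+1 K}}) r
    (p : r.-tuple {poly_n.+1 K}) :
  basis_of V p ->
  wronskian_space m V = <[insubd (0%R : {poly_m.+1 K}) (wronskian p)]>%VS.
Proof.
move=> pV; have rV := size_basis pV.
subst r; have [c c0 cE] := wronskian_basis (vbasisP V) pV.
rewrite /wronskian_space cE.
have -> : insubd (0 : {poly_m.+1 K}) (c *: wronskian p) =
          c *: insubd (0 : {poly_m.+1 K}) (wronskian p).
  apply: val_inj; rewrite /= !val_insubd !qualifE /= size_scale //.
  by case: ifP; rewrite ?scaler0.
apply/eqP; rewrite eqEsubv -!memvE memvZ ?memv_line //=.
by rewrite -[X in X \in _](scalerK c0) memvZ ?memv_line.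
Qed.

End Wronskian.

(* Main.v *)
Require Import Defs.
From mathcomp Require Import all_boot all_algebra zify perm reals complex.
Import GRing.Theory.
Local Open Scope ring_scope.
Set Implicit Arguments.
Unset Strict Implicit.

(** The theorem is Jacobi's complementary minor identity, once the apolar form
    is read as a differential expression.

    The sum over i of (-1)^i u^(i) v^(n-i) has zero derivative when u and v have
    degree at most n, because the derivative telescopes; hence it is a constant,
    and its value at 0 is n! gamma(u, v) ([apolar_form_derivn]).

    Let p be a basis of U, let s complete it to a basis r of the whole space, and
    let q be a basis of U^*. Put M = (r_i^(j)), a square matrix of size n+1, and
    B = ((-1)^j q_i^(n-j)), with n+1 rows indexed by j and columns by i. The
    identity above says that M B is a constant matrix: its upper k rows vanish
    since q is orthogonal to U, and its lower l rows form a constant matrix G.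
    Writing B1 and B2 for the upper k and the lower l rows of B,
<<
      M * [ 1  B1 ]  =  [ A  0 ]      A = (p_i^(j)), i, j < k,
          [ 0  B2 ]     [ *  G ]
>>
    so that det M * det B2 = W(p) * det G. The matrix B2 is the transpose of the
    Wronskian matrix of q with its rows permuted and signed, so det B2 is W(q) up
    to sign. What remains is that det M and det G are nonzero constants
    ([wronskian_apolar_dual]).

    Both follow from one fact, valid in characteristic 0: a basis of an
    r-dimensional subspace of P_n has a nonzero Wronskian, of degree at most
    r(n+1-r) ([wronskian_basis_size]). Indeed det M = W(r) then has degree 0, and
    det G is nonzero because det M and W(q) are. To prove the fact one takes a
    basis with distinct degrees d_i: the leading coefficient of its Wronskian is
    the product of those of the basis times the Vandermonde determinant of the
    d_i.

    Finally dim U^* = n+1-k holds since the form is nondegenerate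
    ([dim_apolar_dual]). *)

(** * Leading coefficients of determinants *)

Lemma horner_falling (R : comNzRingType) (d j : nat) :
  (\prod_(0 <= m < j) ('X - m%:R%:P)).[d%:R] = (d ^_ j)%:R :> R.
Proof.
elim: j => [|j IHj]; first by rewrite big_nil hornerC.
rewrite big_nat_recr //= hornerM IHj hornerXsubC ffactnSr natrM.
case: (leqP j d) => [jd | dj]; first by rewrite natrB.
by rewrite ffact_small // !mul0r.
Qed.

(** The falling factorials x(x-1)...(x-j+1) are monic of degree j in x, so
    their matrix of values differs from a Vandermonde matrix by a unitriangular
    factor. *)
Lemma det_falling (R : comNzRingType) (r : nat) (d : 'I_r -> nat) :
  \det (\matrix_(i < r, j < r) (d i ^_ j)%:R) =
  \prod_(i < r) \prod_(j < r | (i < j)%N) ((d j)%:R - (d i)%:R) :> R.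
Proof.
pose P (j : nat) : {poly R} := \prod_(0 <= m < j) ('X - m%:R%:P).
have sP j : size (P j) = j.+1 by rewrite size_prod_XsubC size_iota subn0.
have mP j : P j \is monic by apply: monic_prod_XsubC.
pose x : 'rV[R]_r := \row_i (d i)%:R.
pose T : 'M[R]_r := \matrix_(j, m) (P j)`_m.
have -> : \matrix_(i < r, j < r) (d i ^_ j)%:R = (Vandermonde r x)^T *m T^T.
  apply/matrixP => i j; rewrite !mxE -horner_falling -/(P j).
  rewrite (horner_coef_wide (n := r)) ?sP //; apply: eq_bigr => m _.
  by rewrite !mxE mulrC.
rewrite det_mulmx !det_tr det_Vandermonde det_trig ?[X in _ * X]big1 ?mulr1.
- by apply: eq_bigr => i _; apply: eq_bigr => j _; rewrite !mxE.
- by move=> i _; rewrite mxE; have /monicP := mP i; rewrite /lead_coef sP.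
- by apply/is_trig_mxP => i j ij; rewrite mxE nth_default // sP.
Qed.

Lemma coef_top_mul (R : nzSemiRingType) (a b : nat) (p q : {poly R}) :
  (size p <= a.+1)%N -> (size q <= b.+1)%N ->
  (size (p * q)%R <= (a + b).+1)%N /\ (p * q)`_(a + b) = p`_a * q`_b.
Proof.
move=> pa qb; split.
  apply: leq_trans (size_polyMleq _ _) _; have := leq_add pa qb.
  by rewrite addSn addnS; case: (_ + _)%N.
have lt_a : (a < (a + b).+1)%N by rewrite ltnS leq_addr.
rewrite coefM (bigD1 (Ordinal lt_a)) //= addKn big1 ?addr0 // => j jNa.
have [aj|ja|aj] := ltngtP a j; last by rewrite -val_eqE /= -aj eqxx in jNa.
  by rewrite nth_default ?mul0r // (leq_trans pa).
by rewrite [q`_ _]nth_default ?mulr0 // (leq_trans qb) // ltn_subRL ltn_add2r.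
Qed.

(** The coefficient is taken at a bound d_i for the degree, rather than at the
    degree itself, so that the rule survives sums with cancellation, as in a
    determinant. *)
Lemma coef_top_prod (R : comNzRingType) (I : Type) (s : seq I)
    (F : I -> {poly R}) (d : I -> nat) :
  (forall i, (size (F i) <= (d i).+1)%N) ->
  (size (\prod_(i <- s) F i)%R <= (\sum_(i <- s) d i).+1)%N /\
  (\prod_(i <- s) F i)`_(\sum_(i <- s) d i) = \prod_(i <- s) (F i)`_(d i).
Proof.
move=> Fd; elim: s => [|i s [ss cs]]; first by rewrite !big_nil size_poly1 coef1.
by rewrite !big_cons -cs; exact: coef_top_mul.
Qed.

(** When row i has degree at most d_i, every term of the Leibniz expansion has
    degree at most the sum of the d_i, so the coefficients there again form a
    Leibniz expansion. *)
Lemma coef_top_det (R : comNzRingType) (r : nat) (E : 'M[{poly R}]_r)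
    (d : 'I_r -> nat) : (forall i j, (size (E i j) <= (d i).+1)%N) ->
  (size (\det E)%R <= (\sum_i d i).+1)%N /\
  (\det E)`_(\sum_i d i) = \det (\matrix_(i, j) (E i j)`_(d i)).
Proof.
move=> Ed; have Es (s : {perm 'I_r}) :=
  coef_top_prod (index_enum 'I_r) (F := fun i => E i (s i)) (fun i => Ed i (s i)).
split.
  apply: leq_trans (size_sum _ _ _) _; apply/bigmax_leqP => s _.
  by rewrite size_Msign; case: (Es s).
rewrite coef_sum; apply: eq_bigr => s _.
rewrite -[in LHS]signr_odd -[in RHS]signr_odd; case: odd;
  rewrite ?expr1 ?expr0 ?mulN1r ?mul1r ?coefN.
  by rewrite (Es s).2; congr (- _); apply: eq_bigr => i _; rewrite mxE.
by rewrite (Es s).2; apply: eq_bigr => i _; rewrite mxE.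
Qed.

Lemma natr_inj_pchar0 (K : fieldType) : [pchar K] =i pred0 ->
  injective (fun m : nat => m%:R : K).
Proof.
move=> /pcharf0P natK0.
have le_inj (a b : nat) : (a <= b)%N -> a%:R = b%:R :> K -> a = b.
  move=> ab /eqP; rewrite eq_sym -subr_eq0 -natrB // natK0 subn_eq0 => ba.
  by apply/eqP; rewrite eqn_leq ab.
move=> a b /= ab; have [/le_inj|/le_inj/(_ (esym ab))//] := orP (leq_total a b).
exact.
Qed.

(** * The degree of a Wronskian *)

(** Multiplying column j of the Wronskian matrix by X^j makes row i have degree
    exactly d_i in each nonzero entry, with leading coefficients the falling
    factorials of d_i; the top coefficient of the determinant is then a
    Vandermonde determinant, nonzero as the d_i are distinct. *)
Lemma wronskian_distinct_sizes (K : fieldType) (charK : [pchar K] =i pred0)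
    (n r : nat) (p : r.-tuple {poly_n.+1 K}) (d : 'I_r -> nat) :
  injective d -> (forall i, size (tnth p i) = (d i).+1) ->
  wronskian p != 0 /\
  (size (wronskian p) + \sum_(j < r) j = (\sum_i d i).+1)%N.
Proof.
move=> inj_d size_p.
pose E : 'M[{poly K}]_r := \matrix_(i, j) ((polyn (tnth p i))^`(j) * 'X^j).
have coefE i j m : (E i j)`_m = (tnth p i)`_m *+ m ^_ j.
  rewrite mxE coefMXn; case: ltnP => [mj|jm]; first by rewrite ffact_small.
  by rewrite coef_derivn subnKC.
have sizeE i j : (size (E i j) <= (d i).+1)%N.
  by apply/leq_sizeP => m dm; rewrite coefE nth_default ?mul0rn ?size_p.
have detE : \det E = wronskian p * 'X^(\sum_(j < r) j).
  have -> : E = (\matrix_(i, j) (polyn (tnth p i))^`(j)) *m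
      diag_mx (\row_(j < r) 'X^j).
    by apply/matrixP => i j; rewrite mul_mx_diag !mxE.
  rewrite det_mulmx det_diag; congr (_ * _).
  by rewrite -prodrXr; apply: eq_bigr => j _; rewrite mxE.
have [size_det coef_det] := coef_top_det sizeE.
have top_neq0 : (\det E)`_(\sum_i d i) != 0.
  rewrite coef_det.
  have -> : \matrix_(i, j) (E i j)`_(d i) =
     diag_mx (\row_i (tnth p i)`_(d i)) *m \matrix_(i < r, j < r) (d i ^_ j)%:R.
    by apply/matrixP => i j; rewrite mul_diag_mx [LHS]mxE coefE !mxE mulr_natr.
  rewrite det_mulmx det_diag det_falling mulf_neq0 //; apply/prodf_neq0 => i _.
    rewrite mxE -[d i]/((d i).+1.-1) -size_p -/(lead_coef _) lead_coef_eq0.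
    by rewrite -size_poly_eq0 size_p.
  apply/prodf_neq0 => j ij; rewrite subr_eq0.
  by apply: contraTneq ij => /natr_inj_pchar0/inj_d->; rewrite ?ltnn.
have det_neq0 : \det E != 0.
  by apply: contraNneq top_neq0 => ->; rewrite coef0.
have W_neq0 : wronskian p != 0.
  by apply: contraNneq det_neq0 => W0; rewrite detE W0 mul0r.
have size_detE : size (\det E) = (size (wronskian p) + \sum_(j < r) j)%N.
  by rewrite detE size_Mmonic ?monicXn // size_polyXn addnS.
split=> //; rewrite -size_detE; apply/eqP.
rewrite eqn_leq size_det ltnNge; apply: contra top_neq0 => ?.
by rewrite nth_default.
Qed.

(** Gaussian elimination from the top degree downwards: the subspace of the
    elements of U with smaller degree is the kernel of a coordinate, so it has
    codimension at most one, and any element outside it extends a basis of it. *)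
Lemma basis_decreasing_sizes (K : fieldType) (n : nat)
    (V : {vspace {poly_n K}}) :
  exists2 s : seq {poly_n K}, basis_of V s &
    path gtn n.+1 [seq size (polyn p) | p <- s].
Proof.
suff bound (m : nat) (U : {vspace {poly_n K}}) :
    {in U, forall p : {poly_n K}, (size p <= m)%N} ->
  exists2 s : seq {poly_n K}, basis_of U s &
    path gtn m.+1 [seq size (polyn p) | p <- s].
  by apply: bound => p _; exact: size_npoly.
elim: m U => [|m IHm] U Um.
  exists [::] => //; suff -> : U = 0%VS by exact: nil_basis.
  apply/eqP; rewrite -subv0; apply/subvP => p /Um; rewrite leqn0 size_poly_eq0.
  by move=> /eqP p0; rewrite memv0; apply/eqP/val_inj.
have weaken : (exists2 s : seq {poly_n K}, basis_of U s &
    path gtn m.+1 [seq size (polyn p) | p <- s]) ->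
  exists2 s : seq {poly_n K}, basis_of U s &
    path gtn m.+2 [seq size (polyn p) | p <- s].
  move=> [s Us sm]; exists s => //; apply: path_le sm; last exact: ltnSn.
  by move=> b a c ba cb; exact: ltn_trans cb ba.
case: (ltnP m n) => [mn|nm]; last first.
  by apply/weaken/IHm => p _; exact: leq_trans (size_npoly p) nm.
pose f := linfun (coord (npolyX K n) (Ordinal mn) : _ -> K^o).
have fE (p : {poly_n K}) : f p = p`_m by rewrite lfunE /= npolyX_coords.
have kerfE (p : {poly_n K}) : p \in U -> (p \in lker f) = (size p <= m)%N.
  move=> /Um pm; rewrite memv_ker fE; apply/eqP/idP => [p0|?]; last exact: nth_default.
  apply/leq_sizeP => j; rewrite leq_eqVlt => /predU1P[<- //|mj].
  by rewrite nth_default // (leq_trans pm).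
have [sUk|/subvPn[p pU pNk]] := boolP (U <= lker f)%VS.
  by apply/weaken/IHm => p pU; rewrite -kerfE // (subvP sUk).
have [|s Us sm] := IHm (U :&: lker f)%VS.
  by move=> q /memv_capP[qU]; rewrite kerfE.
have spE : size p = m.+1.
  by apply/eqP; rewrite eqn_leq Um //= ltnNge -kerfE.
exists (p :: s); last by rewrite /= spE /= ltnSn.
rewrite basisEfree free_cons (basis_free Us) (span_basis Us) memv_cap (negPf pNk).
rewrite andbF andbT /= span_cons (span_basis Us) subv_add -memvE pU capvSl /=.
rewrite -(limg_ker_dim f U) (size_basis (X := in_tuple s) Us) addnC -add1n leq_add2r.
by have := dimvS (subvf (f @: U)); rewrite dimvf.
Qed.

Lemma nth_decreasing (N : nat) (t : seq nat) (i : nat) :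
  path gtn N t -> (i < size t)%N -> (nth 0 t i + i < N)%N.
Proof.
elim: t N i => // a t IHt N [|i] /= /andP[aN pt] it; first by rewrite addn0.
by rewrite addnS; apply: leq_trans aN; rewrite ltnS; exact: IHt.
Qed.

(** Changing the basis only scales the Wronskian, so the basis may be taken with
    decreasing degrees d_0 > d_1 > ... at most n. Then d_i <= n - i, which bounds
    the degree of the Wronskian, the sum of the d_i minus that of the i < r. *)
Lemma wronskian_basis_size (K : fieldType) (charK : [pchar K] =i pred0)
    (n r : nat) (V : {vspace {poly_n.+1 K}}) (p : r.-tuple {poly_n.+1 K}) :
  basis_of V p ->
  wronskian p != 0 /\ (size (wronskian p) <= (r * (n.+1 - r)).+1)%N.
Proof.
move=> Vp; have dimV := size_basis Vp.
have [s Vs ds] := basis_decreasing_sizes V.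
have ss : size s == r by rewrite -dimV (size_basis (X := in_tuple s) Vs).
pose q := Tuple ss.
have [c c0 ->] := wronskian_basis Vp (q := q) Vs.
pose d i := (size (tnth q i)).-1.
have nthE (i : 'I_r) : nth 0 [seq size (polyn u) | u <- s] i = size (tnth q i).
  by rewrite (nth_map 0) ?(eqP ss) // (tnth_nth 0).
have size_q i : size (tnth q i) = (d i).+1.
  rewrite prednK // lt0n size_poly_eq0.
  have : tnth q i != 0 by apply: (free_not0 (basis_free Vs)); exact: mem_tnth.
  by apply: contra => /eqP q0; apply/eqP/val_inj.
have inj_d : injective d.
  move=> i j /(congr1 succn); rewrite -!size_q -!nthE => /eqP.
  rewrite nth_uniq ?size_map ?(eqP ss) // => [/eqP/val_inj //|].
  apply: sorted_uniq (path_sorted ds) => [b a e ba eb|a]; first exact: ltn_trans eb ba.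
  exact: ltnn.
have d_bound (i : 'I_r) : (d i + i <= n)%N.
  have := nth_decreasing (i := i) ds; rewrite size_map (eqP ss) ltn_ord.
  by rewrite nthE size_q addSn !ltnS; apply.
have [W0 sizeW] := wronskian_distinct_sizes charK inj_d size_q.
split; first by rewrite scaler_eq0 negb_or c0.
rewrite size_scale // -(leq_add2r (\sum_(j < r) j)) sizeW addSn ltnS.
(* Pairing d_(r-1-i) with i reduces the bound to d_(r-1-i) <= (n+1-r) + i. *)
rewrite [X in (X <= _)%N](reindex_inj rev_ord_inj) /=.
rewrite -[X in (X * _ + _)%N]card_ord -sum_nat_const -big_split /=.
apply: leq_sum => i _; have := d_bound (rev_ord i).
rewrite /=; have := ltn_ord i; move: (d _) => a; lia.
Qed.

(** * The apolar form *)

Lemma apolar_form_coef (K : fieldType) (n : nat) (u v : {poly_n.+1 K}) :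
  apolar_form u v = \sum_(i < n.+1)
    (u`_i * i`!%:R) * (v`_(n - i) * (n - i)`!%:R) * ((-1) ^+ i / n`!%:R).
Proof.
apply: eq_bigr => i _.
have lt_ni : (n - i < n.+1)%N by rewrite ltnS leq_subr.
have le_in : (i <= n)%N by rewrite -ltnS.
rewrite (bigD1 (Ordinal lt_ni)) //= subnKC // eqxx big1 ?addr0 // => j jN.
rewrite ifN ?mulr0 //; apply: contra jN => /eqP ijn.
by apply/eqP/val_inj; rewrite /= -(addKn i j) ijn.
Qed.

(** This is the translation invariance of the form: the i-th derivatives at any
    point can replace those at 0. Each term differentiates into a difference of
    consecutive values of G i = (-1)^i u^(i) v^(n+1-i), and G vanishes at both
    ends because u^(n+1) = v^(n+1) = 0. *)
Lemma apolar_form_derivn (K : fieldType) (charK : [pchar K] =i pred0)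
    (n : nat) (u v : {poly_n.+1 K}) :
  \sum_(i < n.+1) (-1) ^+ i *: ((polyn u)^`(i) * (polyn v)^`(n - i)) =
  (n`!%:R * apolar_form u v)%:P.
Proof.
set S := \sum_(i < _) _.
have derivn0 (w : {poly_n.+1 K}) : (polyn w)^`(n.+1) = 0.
  by apply/polyP => i; rewrite coef_derivn nth_default ?mul0rn ?coef0 //
     (leq_trans (size_npoly w)) ?leq_addr.
have dS : S^`() = 0.
  pose G i := (-1) ^+ i *: ((polyn u)^`(i) * (polyn v)^`(n.+1 - i)).
  have -> : S^`() = \sum_(0 <= i < n.+1) - (G i.+1 - G i).
    rewrite /S (raddf_sum (deriv : {additive _ -> _})) big_mkord /=.
    apply: eq_bigr => i _; have le_in : (i <= n)%N by rewrite -ltnS.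
    rewrite /G subSS subSn // exprS mulN1r scaleNr derivZ derivM !derivnS.
    by rewrite scalerDr opprB addrC opprK.
  rewrite sumrN telescope_sumr // /G subnn subn0 !derivn0 !(mul0r, mulr0).
  by rewrite !scaler0 subrr oppr0.
(* In characteristic 0 a polynomial with zero derivative is a constant. *)
have -> : S = (S`_0)%:P.
  apply: size1_polyC; apply/leq_sizeP => -[//|j] _.
  have /(congr1 (fun q : {poly K} => q`_j)) := dS; rewrite coef_deriv coef0.
  rewrite -mulr_natr => /eqP; rewrite mulf_eq0 (pcharf0P _).1 // orbF.
  by move/eqP.
congr _%:P; rewrite /S coef_sum apolar_form_coef mulr_sumr; apply: eq_bigr => i _.
have n0 : (n`!%:R : K) != 0 by rewrite (pcharf0P _).1 // -lt0n fact_gt0.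
rewrite [RHS]mulrC -[RHS]mulrA divfK // [RHS]mulrC coefZ; congr (_ * _).
rewrite coefM big_ord1 subnn !coef_derivn !addn0 !ffactnn.
by rewrite !mulr_natr.
Qed.

(** Each vector imposes at most one linear condition. *)
Lemma leq_dim_orthov_span (K : fieldType) (eps : bool) (theta : {rmorphism K -> K})
    (vT : vectType K) (form : {hermitian vT for eps & theta})
    (W : {vspace vT}) (X : seq vT) :
  (\dim W <= \dim (W :&: orthov form <<X>>) + size X)%N.
Proof.
elim: X => [|x X IHX]; first by rewrite span_nil orthov0 capvf addn0.
apply: leq_trans IHX _; rewrite -addSnnS leq_add2r.
have := leq_dim_orthov1 form x (W :&: orthov form <<X>>).
rewrite -ltnS => /(leq_trans (leqSpred _))/leq_trans; apply.
rewrite ltnS; apply/dimvS/subvP => u.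
move=> /memv_capP[/memv_capP[uW /mem_orthovP uX] /mem_orthovP ux].
rewrite memv_cap uW; apply/mem_orthovP => v.
rewrite span_cons => /memv_addP[a ax [b bX ->]].
by rewrite linearDr /= ux // uX // addr0.
Qed.

Lemma apolar_form_nondegenerate (K : fieldType) (charK : [pchar K] =i pred0)
    (n : nat) : apolar_dual (fullv : {vspace {poly_n.+1 K}}) = 0%VS.
Proof.
apply/eqP; rewrite -subv0; apply/subvP => u /apolar_dualP u_full; rewrite memv0.
have nat_neq0 m : ((m`!)%:R : K) != 0 by rewrite (pcharf0P _).1 // -lt0n fact_gt0.
apply/eqP/val_inj/polyP => i; rewrite coef0.
have [ni|lt_in] := leqP n.+1 i.
  by rewrite nth_default // (leq_trans (size_npoly u)).
(* Pairing with z^(n-i) extracts the i-th coefficient up to a nonzero factor. *)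
have /eqP := u_full (npolyp n.+1 'X^(n - i)) (memvf _).
rewrite apolar_form_coef (bigD1 (Ordinal lt_in)) //= [X in _ + X]big1 ?addr0 => [|j jNi].
  rewrite coef_npolyp ltnS leq_subr coefXn eqxx mul1r !mulf_eq0 invr_eq0 signr_eq0.
  by rewrite !(negPf (nat_neq0 _)) !orbF => /eqP.
rewrite coef_npolyp coefXn [(_ - _ == _)%N](_ : _ = false) ?if_same ?mul0r ?mulr0 ?mul0r //.
by apply: contraNF jNi => /eqP ij; apply/eqP/val_inj => /=; have := ltn_ord j; lia.
Qed.

(** Orthogonality to U imposes at most dim U conditions, which gives one
    inequality. Orthogonality to a complement of U imposes at most n+1 - dim U
    further conditions, and these reduce U^* to the radical, which is 0. *)
Lemma dim_apolar_dual (K : fieldType) (charK : [pchar K] =i pred0)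
    (n : nat) (U : {vspace {poly_n.+1 K}}) :
  \dim (apolar_dual U) = (n.+1 - \dim U)%N.
Proof.
have span_vbasis (V : {vspace {poly_n.+1 K}}) : <<vbasis V>>%VS = V.
  exact: span_basis (vbasisP V).
have lower := leq_dim_orthov_span
  (@apolar_form K n : {hermitian _ for odd n & idfun}) fullv (vbasis U).
have upper := leq_dim_orthov_span
  (@apolar_form K n : {hermitian _ for odd n & idfun}) (apolar_dual U) (vbasis U^C).
rewrite span_vbasis size_tuple capfv dim_polyn -/(apolar_dual U) in lower.
rewrite span_vbasis size_tuple dimv_compl dim_polyn in upper.
suff dual0 : (apolar_dual U :&: apolar_dual U^C)%VS = 0%VS.
  rewrite -/(apolar_dual U^C) dual0 dimv0 add0n in upper.
  by apply/eqP; rewrite eqn_leq upper leq_subLR addnC.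
apply/eqP; rewrite -subv0 -(apolar_form_nondegenerate charK).
apply/subvP => u /memv_capP[/apolar_dualP uU /apolar_dualP uC].
apply/apolar_dualP => v; rewrite -(addv_complf U) => /memv_addP[a aU [b bC ->]].
by rewrite linearDr /= uU // uC // addr0.
Qed.

(** * Complementary minors *)

(** Adjoining to M the rows of a basis s of a complement of U makes it square;
    then both determinants in the block identity displayed at the top can be
    computed. *)
Lemma wronskian_apolar_dual (K : fieldType) (charK : [pchar K] =i pred0)
    (n k l : nat) (U : {vspace {poly_n.+1 K}})
    (p : k.-tuple {poly_n.+1 K}) (q : l.-tuple {poly_n.+1 K}) :
  basis_of U p -> basis_of (apolar_dual U) q ->
  exists2 c : K, c != 0 & wronskian p = c *: wronskian q.
Proof.
move=> Up Uq.
have dimU : \dim U = k := size_basis Up.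
have k_le : (k <= n.+1)%N by have := dimvS (subvf U); rewrite dim_polyn dimU.
have kl : (k + l = n.+1)%N.
  by rewrite -(size_basis Uq) dim_apolar_dual // dimU subnKC.
have size_compl : size (vbasis U^C) == l.
  by rewrite size_tuple dimv_compl dimU dim_polyn -kl addKn.
pose s := Tuple size_compl.
pose r := [tuple of p ++ s].
have full_r : basis_of fullv r.
  rewrite -(addv_complf U); apply: cat_basis => //; last exact: vbasisP.
  exact/directv_addP/capv_compl.
(* For the whole space the degree bound is 0. *)
have [Wr_neq0 size_Wr] := wronskian_basis_size charK full_r.
have kl0 : (n.+1 - (k + l) = 0)%N by rewrite kl subnn.
rewrite kl0 muln0 in size_Wr.
have [m m0 WrE] : exists2 m, m != 0 & wronskian r = m%:P.
  exists (wronskian r)`_0; last exact: size1_polyC.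
  by apply: contra Wr_neq0 => /eqP W0; rewrite (size1_polyC size_Wr) W0.
have [Wq_neq0 _] := wronskian_basis_size charK Uq.
pose M : 'M[{poly K}]_(k + l) := \matrix_(i, j) (polyn (tnth r i))^`(j).
pose B : 'M[{poly K}]_(k + l, l) :=
  \matrix_(j, i) ((-1) ^+ j *: (polyn (tnth q i))^`(n - j)).
pose G : 'M[K]_(l, l) :=
  \matrix_(i, j) (n`!%:R * apolar_form (tnth s i) (tnth q j)).
have MB : M *m B = col_mx 0 (map_mx polyC G).
  apply/matrixP => i j.
  transitivity (n`!%:R * apolar_form (tnth r i) (tnth q j))%:P.
    have sumE (F : nat -> {poly K}) : \sum_(a < n.+1) F a = \sum_(a < k + l) F a.
      by rewrite kl.
    rewrite -apolar_form_derivn //.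
    rewrite (sumE (fun a => (-1) ^+ a *: ((polyn (tnth r i))^`(a) *
                                          (polyn (tnth q j))^`(n - a)))).
    by rewrite mxE; apply: eq_bigr => a _; rewrite !mxE scalerAr.
  have dual_q v : v \in U -> apolar_form v (tnth q j) = 0.
    move=> vU; rewrite apolar_form_sym.
    have /apolar_dualP-> // := basis_mem Uq (mem_tnth j q).
    by rewrite mulr0.
  rewrite -(splitK i); case: (split i) => i' /=.
    rewrite col_mxEu mxE tnth_lshift dual_q ?mulr0 //.
    by apply: basis_mem Up _; exact: mem_tnth.
  by rewrite col_mxEd !mxE tnth_rshift.
have [e e0 detBd] : exists2 e, e != 0 & \det (dsubmx B) = e *: wronskian q.
  (* Row k + i of B holds derivatives of order n - (k + i) = l - 1 - i. *)
  pose rev_perm : {perm 'I_l} := perm rev_ord_inj.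
  exists ((\prod_(i < l) (-1) ^+ (k + i)) * (-1) ^+ rev_perm).
    by rewrite mulf_neq0 ?signr_eq0 //; apply/prodf_neq0 => i _; rewrite signr_eq0.
  have -> : dsubmx B = diag_mx (\row_(i < l) ((-1) ^+ (k + i))%:P) *m
      row_perm rev_perm (\matrix_(i, j) (polyn (tnth q i))^`(j))^T.
    apply/matrixP => i j; rewrite mul_diag_mx !mxE mul_polyC /= permE /=.
    by congr (_ *: _^`(_)); lia.
  rewrite row_permE !det_mulmx det_diag det_perm det_tr -[\det _]/(wronskian q).
  rewrite -mul_polyC polyCM rmorph_prod rmorphXn /= polyCN mulrA.
  by congr (_ * _ * _); apply: eq_bigr => i _; rewrite mxE.
have detM : \det M = m%:P by exact: WrE.
have key : m%:P * \det (dsubmx B) = wronskian p * (\det G)%:P.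
  have -> : wronskian p = \det (ulsubmx M).
    by congr (\det _); apply/matrixP => i j; rewrite !mxE tnth_lshift.
  have -> : \det (dsubmx B) = \det (block_mx 1%:M (usubmx B) 0 (dsubmx B)).
    by rewrite det_ublock det1 mul1r.
  rewrite -detM -det_map_mx -(det_lblock _ (dlsubmx M)) -det_mulmx; congr (\det _).
  have -> : block_mx 1%:M (usubmx B) 0 (dsubmx B) = row_mx (col_mx 1%:M 0) B.
    by rewrite -[in RHS](vsubmxK B) -block_mxEh.
  rewrite mul_mx_row MB block_mxEh; congr row_mx.
  by rewrite -[in LHS](submxK M) block_mxEh mul_row_col mulmx1 mulmx0 addr0.
(* W(q) is nonzero, hence so is the left-hand side of [key]. *)
have G0 : \det G != 0.
  have : m%:P * \det (dsubmx B) != 0.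
    by rewrite detBd mul_polyC !scaler_eq0 !negb_or m0 e0.
  by rewrite key mulf_eq0 polyC_eq0 negb_or => /andP[].
exists ((\det G)^-1 * (m * e)); first by rewrite !mulf_neq0 ?invr_eq0.
rewrite -!scalerA -detBd -[m *: _]mul_polyC key mulrC mul_polyC scalerA.
by rewrite mulVf // scale1r.
Qed.

Theorem theorem4p7 (R : realType) (n k : nat) (hk : (1 <= k <= n.+1)%N)
  (U : {vspace {poly_n.+1 R[i]}}) (hU : U \in grassmannian {poly_n.+1 R[i]} k) :
  let l := (n.+1 - k)%N in
  [/\ apolar_dual U \in grassmannian {poly_n.+1 R[i]} l,
      wronskian_space (k * l) U \in grassmannian {poly_(k * l).+1 R[i]} 1 &
      wronskian_space (k * l) U = wronskian_space (k * l) (apolar_dual U)].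
Proof.
have charC : [pchar R[i]] =i pred0 by exact: Num.Theory.pchar_num.
move=> l; have dimU : \dim U = k by apply/eqP.
have dim_dual : \dim (apolar_dual U) = l by rewrite dim_apolar_dual // dimU.
have [W0 sizeW] : wronskian (vbasis U) != 0 /\
    (size (wronskian (vbasis U)) <= (k * l).+1)%N.
  by rewrite /l -dimU; exact: wronskian_basis_size (vbasisP U).
have [c c0 WE] := wronskian_apolar_dual charC (vbasisP U) (vbasisP (apolar_dual U)).
pose w : {poly_(k * l).+1 R[i]} := insubd 0 (wronskian (vbasis U)).
pose w' : {poly_(k * l).+1 R[i]} := insubd 0 (wronskian (vbasis (apolar_dual U))).
have wE : polyn w = wronskian (vbasis U) by exact: insubdK.
have ww' : w = c *: w'.
  apply: val_inj; rewrite /= wE WE insubdK //.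
  by move: sizeW; rewrite WE size_scale.
split; first by rewrite inE dim_dual.
- rewrite inE dim_vline; suff -> : w != 0 by [].
  by apply: contraNneq W0 => w0; rewrite -wE w0.
- rewrite /wronskian_space -/w -/w' ww'.
  apply/eqP; rewrite eqEsubv -!memvE memvZ ?memv_line //=.
  by rewrite -[X in X \in _](scalerK c0) memvZ ?memv_line.
Qed.
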